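(* Let $\eta(\mathbf{W})$ be a strictly convex macroscopic entropy function, and consider the vectorial lattice Boltzmann scheme described in the context with all relaxation parameters equal to $\omega$ and with initial condition $\mathbf{f}_\ell(0,x,y)=\mathbf{f}_\ell^{\rm eq}(\mathbf{W}(0,x,y))$ for every $\ell$. Assume moreover that there exists a strictly convex kinetic entropy functional $\mathcal{H}(\mathbf{f}):=\sum_\ell H_\ell(\mathbf{f}_\ell)$, where, for each velocity index $\ell$, $H_\ell(\mathbf{f}_\ell)$ is a strictly convex function for $\mathbf{f}_\ell$ belonging to the set of equilibria $\mathcal{D}_\ell=\{\mathbf{f}_\ell^{\rm eq}(\mathbf{W}):\mathbf{W}\in\mathcal{U}\}$, satisfying: (E1) for every $\mathbf{W}\in\mathcal{U}$, $\ \sum_\ell H_\ell(\mathbf{f}_\ell^{\rm eq}(\mathbf{W}))=\eta(\mathbf{W})$; (E2) for every $\mathbf{f}_\ell\in\mathcal{D}_\ell$, with $\mathbf{W}=\sum_\ell\mathbf{f}_\ell\in\mathcal{U}$, $\ \sum_\ell H_\ell(\mathbf{f}_\ell^{\rm eq}(\mathbf{W}))\le\sum_\ell H_\ell(\mathbf{f}_\ell)$. Then, if $\omega\in(0,1]$, the solution of the scheme satisfies the local entropy inequality $$\mathcal{H}(\mathbf{f}(t+\Delta t,x,y))\le\mathcal{H}(\mathbf{f}(t,x,y))-\frac{\Delta t}{\Delta x}\bigl(\Psi^{\star}_{x+\Delta x,y}(t)-\Psi^{\star}_{x-\Delta x,y}(t)\bigr)-\frac{\Delta t}{\Delta x}\bigl(\Psi^{\star}_{x,y+\Delta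 x}(t)-\Psi^{\star}_{x,y-\Delta x}(t)\bigr),$$ where the fluxes are given by $$\Psi^{\star}_{x+\Delta x,y}(t):=\mu\,\frac{H_{x^-}(\mathbf{f}^{\star}_{x^-}(t,x,y))-H_{x^-}(\mathbf{f}^{\star}_{x^-}(t,x+\Delta x,y))}{\Delta x},\qquad \Psi^{\star}_{x-\Delta x,y}(t):=\mu\,\frac{H_{x^+}(\mathbf{f}^{\star}_{x^+}(t,x-\Delta x,y))-H_{x^+}(\mathbf{f}^{\star}_{x^+}(t,x,y))}{\Delta x},$$ $$\Psi^{\star}_{x,y+\Delta x}(t):=\mu\,\frac{H_{y^-}(\mathbf{f}^{\star}_{y^-}(t,x,y))-H_{y^-}(\mathbf{f}^{\star}_{y^-}(t,x,y+\Delta x))}{\Delta x},\qquad \Psi^{\star}_{x,y-\Delta x}(t):=\mu\,\frac{H_{y^+}(\mathbf{f}^{\star}_{y^+}(t,x,y-\Delta x))-H_{y^+}(\mathbf{f}^{\star}_{y^+}(t,x,y))}{\Delta x}.$$ Moreover, the following estimate on the decrease of the total entropy in the domain holds, for $t\in\Delta t\,\mathbb{N}$: $$\sum_{(x,y)\in(\Delta x(\mathbb{Z}+\frac12))^2}\eta(\mathbf{W}(t,x,y))\le\sum_{(x,y)\in(\Delta x(\mathbb{Z}+\frac12))^2}\eta(\mathbf{W}(0,x,y)).$$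
   Context: Scheme. Let $\Delta t,\Delta x>0$ with $\Delta x^2/\Delta t=\mu>0$ fixed, $t\in\Delta t\,\mathbb{N}$ and $x,y\in\Delta x(\mathbb{Z}+\frac12)$. The discrete velocities are labelled by $\ell\in\{0,x^+,y^+,x^-,y^-\}$, with directions $c_0=(0,0)$, $c_{x^\pm}=(\pm1,0)$, $c_{y^\pm}=(0,\pm1)$; $\sum_\ell$ is over these five labels. To each $\ell$ is associated a distribution function $\mathbf{f}_\ell(t,x,y)\in\mathbb{R}^3$; $\mathbf{f}$ denotes the collection $(\mathbf{f}_\ell)_\ell$. The macroscopic (conserved) quantities are $$\mathbf{W}(t,x,y)=(\rho,\ \Delta x\,q_x,\ \Delta x\,q_y)^{T}(t,x,y)=\sum_\ell\mathbf{f}_\ell(t,x,y).$$ One time step, when all relaxation parameters equal $\omega$, consists of: (i) Relaxation: $\mathbf{f}_\ell^{\star}(t,x,y)=(1-\omega)\mathbf{f}_\ell(t,x,y)+\omega\,\mathbf{f}_\ell^{\rm eq}(\mathbf{W}(t,x,y))$. (ii) Transport: $\mathbf{f}_\ell(t+\Delta t,(x,y))=\mathbf{f}_\ell^{\star}(t,(x,y)-\Delta x\,c_\ell)$. The equilibria, as functions of $\mathbf{W}=(\rho,\Delta x\,q_x,\Delta x\,q_y)^T$, are $$\mathbf{f}_0^{\rm eq}=\begin{pmatrix}(1-4\alpha_\rho)\rho\\ (1-4\alpha_{q_x})\Delta x\,q_x\\ (1-4\alpha_{q_y})\Delta x\,q_y\end{pmatrix},$$ $$\mathbf{f}_{x^\pm}^{\rm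 eq}=\begin{pmatrix}\alpha_\rho\rho\pm\frac{\Delta x}{2\mu}q_x\\ \Delta x\,\alpha_{q_x}q_x\pm\frac{\Delta x^2}{2\mu}\frac{q_x^2}{\rho}\pm\frac{1}{2\mu}P(\rho)\\ \Delta x\,\alpha_{q_y}q_y\pm\frac{\Delta x^2}{2\mu}\frac{q_xq_y}{\rho}\end{pmatrix},\qquad \mathbf{f}_{y^\pm}^{\rm eq}=\begin{pmatrix}\alpha_\rho\rho\pm\frac{\Delta x}{2\mu}q_y\\ \Delta x\,\alpha_{q_x}q_x\pm\frac{\Delta x^2}{2\mu}\frac{q_xq_y}{\rho}\\ \Delta x\,\alpha_{q_y}q_y\pm\frac{\Delta x^2}{2\mu}\frac{q_y^2}{\rho}\pm\frac{1}{2\mu}P(\rho)\end{pmatrix},$$ where $\alpha_\rho,\alpha_{q_x},\alpha_{q_y}\in\mathbb{R}$ and $P(\rho)=\rho^\gamma$ with $\gamma\ge1$. Standing assumption: $\mathbf{W}\in\mathcal{U}$, where $\mathcal{U}$ is an open convex subset of $\mathbb{R}^3$. The macroscopic entropy $\eta$ is a strictly convex real-valued function of $\mathbf{W}\in\mathcal{U}$, associated with the target artificially compressible equations for density and momentum. The kinetic entropies $H_\ell$ are real-valued functions of $\mathbf{f}_\ell$, one for each discrete velocity.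
   Formalization: The total-entropy estimate assumes that, at each time and for each ℓ, H_ℓ(f_ℓ) minus some constant is absolutely summable over the lattice; density is positive on 𝒰; H_ℓ is strictly convex on the convex hull of 𝒟_ℓ. *)

(* Defs.v *)
From HB Require Import structures.
From mathcomp Require Import all_boot all_order all_algebra.
From mathcomp Require Import all_classical all_reals all_analysis.
Set Implicit Arguments.
Unset Strict Implicit.
Unset Printing Implicit Defensive.
Import Order.TTheory GRing.Theory Num.Theory.
Import numFieldNormedType.Exports.
Local Open Scope classical_set_scope.
Local Open Scope ring_scope.

Inductive velocity := v0 | vxp | vyp | vxm | vym.

Definition velocity_enum : seq velocity := [:: v0; vxp; vyp; vxm; vym].

Definition velocity_code (l : velocity) : nat :=
  match l with v0 => 0 | vxp => 1 | vyp => 2 | vxm => 3 | vym => 4 end.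

Lemma velocity_codeK :
  pcancel velocity_code (fun n => nth None (map Some velocity_enum) n).
Proof. by case. Qed.

HB.instance Definition _ := Countable.copy velocity (pcan_type velocity_codeK).

Lemma velocity_enumP : Finite.axiom velocity_enum.
Proof. by case. Qed.

HB.instance Definition _ := fintype.isFinite.Build velocity velocity_enumP.

Lemma sum_velocity (V : nmodType) (F : velocity -> V) :
  \sum_l F l = F v0 + F vxp + F vyp + F vxm + F vym.
Proof.
rewrite -big_enum enumT [Finite.enum]unlock /=.
by rewrite /velocity_enum !big_cons big_nil addr0 !addrA.
Qed.

(* The lattice cell (i, j) stands for the point (dx (i + 1/2), dx (j + 1/2)),
   the time index n for the time n dt. *)
Definition site : choiceType := (int * int)%type.

Definition ex : int * int := (1, 0).
Definition ey : int * int := (0, 1).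

Definition direction (l : velocity) : int * int :=
  match l with
  | v0 => 0 | vxp => ex | vyp => ey | vxm => - ex | vym => - ey
  end.

Section Scheme.
Variable R : realType.
Local Notation vec := 'rV[R]_3.

Definition vec3 (a b c : R) : vec := \row_(k < 3) [:: a; b; c]`_k.

(* The state is W = (rho, dx * q_x, dx * q_y). *)
Definition rho (W : vec) : R := W 0 0.
Definition qx (dx : R) (W : vec) : R := W 0 1 / dx.
Definition qy (dx : R) (W : vec) : R := W 0 2 / dx.

Section Equilibrium.
Variables dx mu arho aqx aqy gamma : R.

Definition pressure (r : R) : R := r `^ gamma.

(* s = 1 for the velocity x^+, s = -1 for x^-. *)
Definition eq_x (s : R) (W : vec) : vec :=
  let r := rho W in let u := qx dx W in let v := qy dx W in
  vec3 (arho * r + s * (dx / (2 * mu) * u))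
       (dx * aqx * u + s * (dx ^+ 2 / (2 * mu) * (u ^+ 2 / r))
                     + s * (1 / (2 * mu) * pressure r))
       (dx * aqy * v + s * (dx ^+ 2 / (2 * mu) * (u * v / r))).

Definition eq_y (s : R) (W : vec) : vec :=
  let r := rho W in let u := qx dx W in let v := qy dx W in
  vec3 (arho * r + s * (dx / (2 * mu) * v))
       (dx * aqx * u + s * (dx ^+ 2 / (2 * mu) * (u * v / r)))
       (dx * aqy * v + s * (dx ^+ 2 / (2 * mu) * (v ^+ 2 / r))
                     + s * (1 / (2 * mu) * pressure r)).

Definition equilibrium (l : velocity) (W : vec) : vec :=
  match l with
  | v0 => vec3 ((1 - 4 * arho) * rho W)
               ((1 - 4 * aqx) * (dx * qx dx W))
               ((1 - 4 * aqy) * (dx * qy dx W))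
  | vxp => eq_x 1 W
  | vxm => eq_x (-1) W
  | vyp => eq_y 1 W
  | vym => eq_y (-1) W
  end.

End Equilibrium.

Definition macro (g : velocity -> vec) : vec := \sum_l g l.

Section Evolution.
Variables (feq : velocity -> vec -> vec) (omega : R).

Definition relax (g : velocity -> vec) (l : velocity) : vec :=
  (1 - omega) *: g l + omega *: feq l (macro g).

Definition scheme_solution (f : nat -> site -> velocity -> vec) : Prop :=
  forall n x l, f n.+1 x l = relax (f n (x - direction l)) l.

Definition equilibrium_start (f : nat -> site -> velocity -> vec) : Prop :=
  forall x l, f 0 x l = feq l (macro (f 0 x)).

Definition eq_set (U : set vec) (l : velocity) : set vec := feq l @` U.

End Evolution.

Definition convex_hull (A : set vec) : set vec :=
  smallest (@convex_set R vec) A.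

Definition strictly_convex_on (A : set vec) (F : vec -> R) : Prop :=
  forall x y : vec, A x -> A y -> x != y ->
  forall t : R, 0 < t < 1 ->
    F (t *: x + (1 - t) *: y) < t * F x + (1 - t) * F y.

Section Entropy.
Variable H : velocity -> vec -> R.

Definition kinetic_entropy (g : velocity -> vec) : R := \sum_l H l (g l).

(* Strict convexity of a function on a set D of equilibria which need not be
   convex: the function must make sense at, and be strictly convex along, the
   convex combinations of points of D, which is where the relaxation step
   evaluates it. *)
Definition kinetic_convex (feq : velocity -> vec -> vec) (U : set vec) : Prop :=
  forall l, strictly_convex_on (convex_hull (eq_set feq U l)) (H l).

Definition cond_E1 (feq : velocity -> vec -> vec) (U : set vec)
    (eta : vec -> R) : Prop :=
  forall W, U W -> \sum_l H l (feq l W) = eta W.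

Definition cond_E2 (feq : velocity -> vec -> vec) (U : set vec) : Prop :=
  forall g : velocity -> vec,
    (forall l, eq_set feq U l (g l)) -> U (macro g) ->
    \sum_l H l (feq l (macro g)) <= \sum_l H l (g l).

(* Fluxes of the relaxed distributions fs at one time, through the east, west,
   north and south sides of the cell x. Each side of a cell carries its own
   flux: the east flux of x differs from the west flux of x + ex. *)
Section Flux.
Variables (mu dx : R) (fs : site -> velocity -> vec).

Definition flux_east (x : site) : R :=
  mu * ((H vxm (fs x vxm) - H vxm (fs (x + ex) vxm)) / dx).
Definition flux_west (x : site) : R :=
  mu * ((H vxp (fs (x - ex) vxp) - H vxp (fs x vxp)) / dx).
Definition flux_north (x : site) : R :=
  mu * ((H vym (fs x vym) - H vym (fs (x + ey) vym)) / dx).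
Definition flux_south (x : site) : R :=
  mu * ((H vyp (fs (x - ey) vyp) - H vyp (fs x vyp)) / dx).

End Flux.

(* Absolute convergence on the lattice of the series of each kinetic entropy,
   up to an additive constant. The constant allows for the value of H_l in a
   uniform state at infinity: there only the sum of the H_l over l, not each
   H_l, has to vanish for the total entropy to be finite. *)
Definition kinetic_summable (f : nat -> site -> velocity -> vec) : Prop :=
  forall n l, exists k : R,
    summable [set: site] (fun x => (H l (f n x l) - k)%:E).

End Entropy.

(* Unconditional sum over the lattice of a family of arbitrary sign (\esum is
   meant for nonnegative families). *)
Definition lattice_sum (u : site -> R) : \bar R :=
  ((\esum_(x in [set: site]) ((EFin \o u)^\+ x))
   - (\esum_(x in [set: site]) ((EFin \o u)^\- x)))%E.

End Scheme.

(* Main.v *)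
Require Import Defs.
From mathcomp Require Import all_boot all_order all_algebra.
From mathcomp Require Import all_classical all_reals all_analysis.
From mathcomp Require Import ring lra.
Import Order.TTheory GRing.Theory Num.Theory.
Import numFieldNormedType.Exports.
Local Open Scope classical_set_scope.
Local Open Scope ring_scope.

(** Relaxation takes a convex combination of [f_l] and its equilibrium, and
    transport only moves the values [H_l (f_l)] between cells; with
    [dx ^ 2 / dt = mu] the four fluxes record exactly these moves. The local
    inequality therefore amounts to the decrease of the entropy under relaxation,
    which follows from convexity once the minimisation principle
    [eta (macro g) <= sum_l H_l (g_l)] is known for the distributions [g] that
    occur.

    These distributions are not equilibria: in general [f_l] is only a convex
    combination of equilibria of several earlier states. The heart of the proof
    is the extension of the principle (E2) from the sets of equilibria [D_l] to
    their convex hulls ([entropy_min_on_convex_hull]):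
    - at a generic state [W] the equilibrium map of each moving velocity is
      locally onto, while the equilibria at rest form a convex set. A small step
      from the equilibrium of [W] towards [g] thus stays among the equilibria,
      where (E2) applies: the equilibrium is a local minimum of a convex
      function on the segment, hence a global one
      ([entropy_min_of_absorbing]);
    - every state is the endpoint of a segment on which all states close to it
      are generic ([generic_ray]), since degeneracy is the vanishing of nonzero
      polynomials in the momenta. Mixing [g] with an equilibrium moves its
      macroscopic state along this segment, and the convexity of [eta] allows
      the passage to the endpoint.

    Local surjectivity ([flux_map_locally_onto]) is explicit: two of the three
    equations give the momenta in terms of the density, and what remains is a
    scalar equation for the density, solved by the intermediate value theorem.

    For the total entropy, [lattice_sum] is monotone, and the transport step
    preserves it although each [H_l] has its own constant at infinity
    ([lattice_sum_transport]): the sum depends on the summable parts, each of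
    them shift invariant, and on the sum of the constants only. *)

(** * Local surjectivity of the equilibrium maps *)

Lemma derive_neq0_sign_change {R : realType} (phi : R -> R) (r0 d : R) :
  derivable phi r0 1 -> derive1 phi r0 != 0 -> 0 < d ->
  exists2 h, 0 < h < d &
    (phi (r0 - h) - phi r0) * (phi (r0 + h) - phi r0) < 0.
Proof.
move=> dphi c0 d0.
set c := derive1 phi r0 in c0 *.
have phic : (fun h : R => h^-1 * (phi (h + r0) - phi r0)) @ 0^' --> c.
  rewrite /c derive1E.
  have := dphi; rewrite /derivable /derive.
  under eq_fun do rewrite /= [_%:A]mulr1.
  by [].
have near_sign : \forall h \near 0^', 0 < c * (h^-1 * (phi (h + r0) - phi r0)).
  apply: (cvgr_gt (c * c)); first by apply: cvgM => //; exact: cvg_cst.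
  by rewrite -expr2 exprn_even_gt0.
move: near_sign; rewrite /dnbhs /within /= => /nbhs_ballP[e /= e0 sgn].
pose h := Num.min (e / 2) (d / 2).
have h0 : 0 < h by rewrite lt_min !divr_gt0.
have he : h < e by rewrite gt_min; apply/orP; left; lra.
have hd : h < d by rewrite gt_min; apply/orP; right; lra.
exists h; first by rewrite h0 hd.
have sp : 0 < c * (h^-1 * (phi (h + r0) - phi r0)).
  apply: sgn; last by rewrite gt_eqF.
  by rewrite /ball /= sub0r normrN gtr0_norm.
have sm : 0 < c * ((- h)^-1 * (phi (- h + r0) - phi r0)).
  apply: sgn; last by rewrite oppr_eq0 gt_eqF.
  by rewrite /ball /= sub0r opprK gtr0_norm.
rewrite (addrC r0 h) (addrC r0 (- h)).
have := mulr_gt0 sp sm.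
set A := phi _ - _; set B := phi (- h + r0) - _.
have -> : c * (h^-1 * A) * (c * ((- h)^-1 * B)) = - ((c / h) ^+ 2 * (B * A)).
  by field; rewrite ?oppr_eq0 gt_eqF.
rewrite oppr_gt0 pmulr_rlt0// exprn_even_gt0//= mulf_neq0//.
by rewrite invr_neq0// gt_eqF.
Qed.

(** The equilibrium of a moving velocity in coordinates: [r] is the density, [m]
    the momentum along the velocity, [n] the momentum across it, and [k] is
    [1 / (2 mu)] with the sign of the velocity. *)
Definition flux_map {R : realType} (k al ax ay : R) (P : R -> R) (r m n : R) :=
  (al * r + k * m, ax * m + k * (m ^+ 2 / r + P r), ay * n + k * (m * n / r)).

(** The first component gives [m] from [r], the third then gives [n], both
    affinely, so that only [phi a r = b] is left to solve for [r]. The quantity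
    assumed nonzero first is, up to the factor [- 1 / k], the derivative of
    [phi a0] at [r0]; it makes [phi a0 - b0] change sign near [r0], a property
    that persists for nearby [a] and [b]. The second is the coefficient of [n]
    in the third component. *)
Lemma flux_map_locally_onto {R : realType} (k al ax ay : R) (P : R -> R)
    (r0 m0 n0 : R) :
  k != 0 -> 0 < r0 -> (forall r, 0 < r -> derivable P r 1) ->
  k ^+ 2 * ((m0 / r0) ^+ 2 - derive1 P r0) + 2 * k * al * (m0 / r0) + al * ax != 0 ->
  ay + k * (m0 / r0) != 0 ->
  forall d, 0 < d ->
  \forall t \near flux_map k al ax ay P r0 m0 n0, exists r m n : R,
    [/\ `|r - r0| < d, `|m - m0| < d, `|n - n0| < d &
        t = flux_map k al ax ay P r m n].
Proof.
move=> k0 r00 dP N0 L0 d d0; rewrite /flux_map.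
set a0 := al * r0 + k * m0; set b0 := _ + k * (_ + P r0).
set c0 := ay * n0 + _.
pose m (a r : R) := (a - al * r) / k.
pose L (a r : R) := ay + k * (m a r / r).
pose phi (a r : R) := ax * m a r + k * ((m a r) ^+ 2 / r + P r).
have m00 : m a0 r0 = m0 by rewrite /m /a0; field.
have L00 : L a0 r0 != 0 by rewrite /L m00.
have n00 : c0 / L a0 r0 = n0.
  have -> : c0 = n0 * L a0 r0 by rewrite /c0 /L m00; ring.
  by rewrite mulfK.
have phi0 : phi a0 r0 = b0 by rewrite /phi m00.
have r0N : r0 != 0 by rewrite gt_eqF.
have mcvg : m z.1.1 z.2 @[z --> (a0, c0, r0)] --> m0.
  rewrite -m00 /m; apply: cvgMr_tmp; apply: cvgB.
    exact: (cvg_comp _ _ cvg_fst cvg_fst).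
  by apply: cvgMl_tmp; exact: cvg_snd.
have Lcvg : L z.1.1 z.2 @[z --> (a0, c0, r0)] --> L a0 r0.
  apply: cvgD; first exact: cvg_cst.
  apply: cvgMl_tmp; rewrite m00; apply: cvgM => //.
  by apply: cvgV => //; exact: cvg_snd.
have ncvg : z.1.2 / L z.1.1 z.2 @[z --> (a0, c0, r0)] --> n0.
  rewrite -n00; apply: cvgM; last exact: cvgV.
  exact: (cvg_comp _ _ cvg_fst cvg_snd).
have : \forall z \near (a0, c0, r0),
    [/\ 0 < z.2, `|z.2 - r0| < d, `|m z.1.1 z.2 - m0| < d,
        `|z.1.2 / L z.1.1 z.2 - n0| < d & L z.1.1 z.2 != 0].
  have rcvg : z.2 @[z --> (a0, c0, r0)] --> r0 by exact: cvg_snd.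
  near=> z; split; near: z.
  - exact: (cvgr_gt r0).
  - exact: cvgr_distC_lt.
  - exact: cvgr_distC_lt.
  - exact: cvgr_distC_lt.
  - exact: (cvgr_neq0 (L a0 r0)).
move=> /nbhs_ballP[d1 /= d10 near1].
have Pd : is_derive r0 (1 : R) P (derive1 P r0).
  by rewrite derive1E; apply/derivableP; exact: dP.
have [dphi phi'0] : derivable (phi a0) r0 1 /\ derive1 (phi a0) r0 != 0.
  pose M : R -> R := cst (a0 / k) - ((al / k) \*: id).
  have Mr0 : M r0 = m0.
    by rewrite -m00 /m -[LHS]/(a0 / k - al / k * r0); field.
  have phiE : phi a0 = (ax \*: M) + (k \*: (M * (M * (fun r => r^-1)) + P)).
    apply/funext => r.
    have ME : M r = m a0 r by rewrite /m -[LHS]/(a0 / k - al / k * r); field.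
    rewrite -[RHS]/(ax * M r + k * (M r * (M r * r^-1) + P r)) ME /phi.
    by rewrite mulrA expr2.
  have dM : is_derive r0 (1 : R) M (- (al / k)).
    by apply: is_derive_eq; rewrite sub0r [_ *: _]mulr1.
  have dV : is_derive r0 (1 : R) (fun r : R => r^-1) (- (r0 ^- 2)).
    apply: is_derive_eq; first exact: (is_deriveV (f := id)).
    by rewrite [LHS]mulr1.
  have dphi : is_derive r0 (1 : R) (phi a0)
      (- (k ^+ 2 * ((m0 / r0) ^+ 2 - derive1 P r0) +
          2 * k * al * (m0 / r0) + al * ax) / k).
    rewrite phiE; apply: is_derive_eq.
    rewrite -[(M * _) r0]/(M r0 * r0^-1) !Mr0.
    rewrite -[LHS]/(ax * - (al / k) + k * (m0 * (m0 * - (r0 ^- 2)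
       + r0^-1 * - (al / k)) + m0 / r0 * - (al / k) + derive1 P r0)).
    by field; rewrite k0 r0N.
  split; first exact: ex_derive.
  by rewrite derive1E derive_val mulf_neq0 ?oppr_eq0// invr_neq0.
have [h /andP[h0 hd] sgn] := derive_neq0_sign_change _ _ _ dphi phi'0 d10.
have contm r : m a r @[a --> a0] --> m a0 r.
  by rewrite /m; apply: cvgMr_tmp; apply: cvgB; [exact: cvg_id|exact: cvg_cst].
have contphi r : phi a r @[a --> a0] --> phi a0 r.
  rewrite /phi; apply: cvgD; first by apply: cvgMl_tmp.
  apply: cvgMl_tmp; apply: cvgD; last exact: cvg_cst.
  by apply: cvgMr_tmp; apply: cvgM.
have fstfst : t.1.1 @[t --> (a0, b0, c0)] --> a0.
  exact: (cvg_comp _ _ cvg_fst cvg_fst).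
have fstsnd : t.1.2 @[t --> (a0, b0, c0)] --> b0.
  exact: (cvg_comp _ _ cvg_fst cvg_snd).
have phit r : phi t.1.1 r @[t --> (a0, b0, c0)] --> phi a0 r.
  exact: (cvg_comp (fun t : R * R * R => t.1.1) (phi^~ r) fstfst (contphi r)).
have : \forall t \near (a0, b0, c0), [/\ `|t.1.1 - a0| < d1, `|t.2 - c0| < d1 &
    (phi t.1.1 (r0 - h) - t.1.2) * (phi t.1.1 (r0 + h) - t.1.2) < 0].
  near=> t; split; near: t.
  - exact: cvgr_distC_lt.
  - by apply: cvgr_distC_lt => //; exact: cvg_snd.
  - apply: (cvgr_lt ((phi a0 (r0 - h) - b0) * (phi a0 (r0 + h) - b0))).
      by apply: cvgM; apply: cvgB.
    by rewrite -phi0.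
apply: filterS => -[[a b] c] /= [ad cd ltb].
have rpos r : r0 - h <= r <= r0 + h -> [/\ 0 < r, `|r - r0| < d, `|m a r - m0| < d,
    `|c / L a r - n0| < d & L a r != 0].
  move=> rh; apply: (near1 (a, c, r)); split; first split => /=.
  - by rewrite /ball/= distrC.
  - by rewrite /ball/= distrC.
  - by rewrite /ball/= distrC; rewrite (le_lt_trans _ hd)// ler_distl.
have [r rh phir] : exists2 r, r \in `[r0 - h, r0 + h] & phi a r = b.
  apply: IVT; first by lra.
    apply: continuous_in_subspaceT => x; rewrite inE/= in_itv/= => /rpos[xp _ _ _ _].
    have xN : x != 0 by rewrite gt_eqF.
    have mx : m a y @[y --> x] --> m a x.
      by rewrite /m; apply: cvgMr_tmp; apply: cvgB; [exact: cvg_cst|apply: cvgMl_tmp].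
    rewrite /phi /continuous_at; apply: cvgD; first exact: cvgMl_tmp.
    apply: cvgMl_tmp; apply: cvgD.
      by apply: cvgM; [apply: cvgM|apply: cvgV].
    exact/differentiable_continuous/derivable1_diffP/dP.
  rewrite ge_min le_max.
  have [phim|phim] := lerP (phi a (r0 - h)) b;
  have [phip|phip] := lerP (phi a (r0 + h)) b => //=.
  - suff : 0 <= (phi a (r0 - h) - b) * (phi a (r0 + h) - b) by lra.
    by rewrite mulr_le0// subr_le0.
  - by rewrite (ltW phip) orbT.
  - by rewrite (ltW phim).
  - suff : 0 < (phi a (r0 - h) - b) * (phi a (r0 + h) - b) by lra.
    by rewrite mulr_gt0// subr_gt0.
move: rh; rewrite in_itv/= => rh.
have [rp rd md nd Lr] := rpos _ rh.
exists r, (m a r), (c / L a r); split=> //; congr (_, _, _).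
- by rewrite /m; field.
- by rewrite -phir /phi.
- by move: Lr; rewrite /L => Lr; rewrite -[LHS](mulfVK Lr); ring.
Unshelve. all: by end_near.
Qed.

(** * Minimality of the equilibrium on the convex hulls *)

Lemma convex_setP {R : realType} (A : set 'rV[R]_3) :
  convex_set A <-> forall x y t, 0 <= t <= 1 -> A x -> A y ->
    A (t *: x + (1 - t) *: y).
Proof.
split=> [cA x y t /andP[t0 t1] Ax Ay|cA x y l].
  by have := cA x y (Itv01 t0 t1); rewrite !inE; exact.
by rewrite !inE => Ax Ay; apply: cA => //; apply/andP.
Qed.

Lemma convex_hull_conv {R : realType} (A : set 'rV[R]_3) (x y : 'rV[R]_3) (t : R) :
  0 <= t <= 1 -> convex_hull A x -> convex_hull A y ->
  convex_hull A (t *: x + (1 - t) *: y).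
Proof.
move=> t01 hx hy B AB; have [/convex_setP cB _] := AB.
exact: cB t01 (hx _ AB) (hy _ AB).
Qed.

Lemma sub_convex_hull {R : realType} (A : set 'rV[R]_3) : A `<=` convex_hull A.
Proof. exact: sub_gen_smallest. Qed.

Lemma strictly_convex_on_le {R : realType} (A : set 'rV[R]_3) (F : 'rV[R]_3 -> R)
    (x y : 'rV[R]_3) (t : R) :
  strictly_convex_on A F -> A x -> A y -> 0 <= t <= 1 ->
  F (t *: x + (1 - t) *: y) <= t * F x + (1 - t) * F y.
Proof.
move=> cF Ax Ay /andP[t0 t1].
have [->|xy] := eqVneq x y.
  by rewrite -scalerDl -mulrDl addrC subrK scale1r mul1r.
have [->|tN0] := eqVneq t 0; first by rewrite scale0r mul0r !add0r subr0 scale1r mul1r.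
have [->|tN1] := eqVneq t 1; first by rewrite subrr scale0r mul0r !addr0 scale1r mul1r.
by rewrite ltW// cF// !lt_neqAle eq_sym tN0 t0 tN1.
Qed.

Definition toward {R : realType} (e : R) (x y : 'rV[R]_3) := (1 - e) *: x + e *: y.

Section Dissipation.
Context {R : realType}.
Variables (feq : velocity -> 'rV[R]_3 -> 'rV[R]_3) (U : set 'rV[R]_3).
Variables (H : velocity -> 'rV[R]_3 -> R) (eta : 'rV[R]_3 -> R).
Hypotheses (cH : kinetic_convex H feq U).
Hypothesis E2 : cond_E2 H feq U.
Hypothesis consistent : forall W, U W -> macro (feq ^~ W) = W.

Lemma macroD (g h : velocity -> 'rV[R]_3) (e : R) :
  macro (fun l => toward e (g l) (h l)) = toward e (macro g) (macro h).
Proof. by rewrite /macro /toward big_split /= !scaler_sumr. Qed.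

Lemma kinetic_entropy_toward (g h : velocity -> 'rV[R]_3) (e : R) : 0 <= e <= 1 ->
  (forall l, convex_hull (Defs.eq_set feq U l) (g l)) ->
  (forall l, convex_hull (Defs.eq_set feq U l) (h l)) ->
  kinetic_entropy H (fun l => toward e (g l) (h l)) <=
  (1 - e) * kinetic_entropy H g + e * kinetic_entropy H h.
Proof.
move=> /andP[e0 e1] hg hh; rewrite /kinetic_entropy !mulr_sumr -big_split /=.
apply: ler_sum => l _.
have := strictly_convex_on_le _ _ _ _ (1 - e) (cH l) (hg l) (hh l).
rewrite subKr; apply; apply/andP; split; lra.
Qed.

(** If the segment from the equilibrium to [g] starts among the equilibria, (E2)
    makes its starting point a local minimum of the entropy along it, and a local
    minimum of a convex function is a global one. *)
Lemma entropy_min_of_absorbing (g : velocity -> 'rV[R]_3) : U (macro g) ->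
  (forall l, convex_hull (Defs.eq_set feq U l) (g l)) ->
  (forall l, \forall e \near 0^'+,
     Defs.eq_set feq U l (toward e (feq l (macro g)) (g l))) ->
  kinetic_entropy H (feq ^~ (macro g)) <= kinetic_entropy H g.
Proof.
move=> UW hg absorb; set W := macro g.
have : \forall e \near 0^'+, [/\ 0 < e, e <= 1 &
    forall l, Defs.eq_set feq U l (toward e (feq l W) (g l))].
  have a0 := absorb v0; have a1 := absorb vxp; have a2 := absorb vyp.
  have a3 := absorb vxm; have a4 := absorb vym.
  near=> e; split; [by []|by near: e; apply: nbhs_right_le|].
  by case; near: e.
move=> /filter_ex[e [e0 e1 De]].
pose h l := toward e (feq l W) (g l).
have macroh : macro h = W.
  by rewrite /h macroD consistent// /toward -scalerDl subrK scale1r.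
have hfeq l : convex_hull (Defs.eq_set feq U l) (feq l W).
  by apply: sub_convex_hull; exists W.
have : kinetic_entropy H (feq ^~ W) <= kinetic_entropy H h.
  by rewrite -{1}macroh; apply: E2 => //; rewrite macroh.
have := @kinetic_entropy_toward (feq^~ W) g e; rewrite -/h.
move=> /(_ _ hfeq hg).
have -> : 0 <= e <= 1 by rewrite e1 ltW.
move=> /(_ isT) A B; have := le_trans B A.
set a := kinetic_entropy _ _; set b := kinetic_entropy _ _ => ab.
have : e * a <= e * b by lra.
by rewrite ler_pM2l.
Unshelve. all: by end_near.
Qed.

(** The macroscopic state of a mixture of [g] with the equilibrium of [W + v] is
    [W + e v], where [entropy_min_of_absorbing] applies. As [W] lies between
    [W - v] and [W + e v], convexity of [eta] bounds [eta W] by the value at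
    [W + e v] up to [O(e)], and [e] tends to [0]. *)
Lemma entropy_min_on_convex_hull (generic : set 'rV[R]_3) :
  convex_set U -> strictly_convex_on U eta -> cond_E1 H feq U eta ->
  (forall W, U W -> exists v, [/\ U (W - v), U (W + v) &
     \forall e \near 0^'+, generic (W + e *: v)]) ->
  (forall l W h, U W -> generic W -> convex_hull (Defs.eq_set feq U l) h ->
     \forall e \near 0^'+, Defs.eq_set feq U l (toward e (feq l W) h)) ->
  forall g, U (macro g) -> (forall l, convex_hull (Defs.eq_set feq U l) (g l)) ->
  eta (macro g) <= kinetic_entropy H g.
Proof.
move=> cU ceta E1 dense absorb g UW hg.
set W := macro g in UW *; set K := kinetic_entropy H g.
have [v [Um Up gen]] := dense _ UW.
have bound : \forall e \near 0^'+,
    eta W - K <= e * (eta (W - v) + eta (W + v) - K - eta W).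
  near=> e.
  have e0 : 0 < e by [].
  have e1 : e <= 1 by near: e; exact: nbhs_right_le.
  have e01 : 0 <= e <= 1 by rewrite e1 ltW.
  have gene : generic (W + e *: v) by near: e.
  pose ge l := toward e (g l) (feq l (W + v)).
  have hfeq V l : U V -> convex_hull (Defs.eq_set feq U l) (feq l V).
    by move=> UV; apply: sub_convex_hull; exists V.
  have macroge : macro ge = W + e *: v.
    rewrite /ge macroD consistent// /toward scalerDr addrA -scalerDl subrK.
    by rewrite scale1r.
  have UWe : U (W + e *: v).
    have -> : W + e *: v = e *: (W + v) + (1 - e) *: W.
      by rewrite scalerDr addrAC -scalerDl (addrC e) subrK scale1r.
    exact: (convex_setP U).1.
  have hge l : convex_hull (Defs.eq_set feq U l) (ge l).
    rewrite /ge /toward addrC; apply: convex_hull_conv => //; exact: hfeq.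
  have etage : eta (W + e *: v) <= kinetic_entropy H ge.
    rewrite -(E1 _ UWe) -macroge.
    apply: entropy_min_of_absorbing => //; rewrite macroge// => l.
    exact: absorb.
  have kge : kinetic_entropy H ge <= (1 - e) * K + e * eta (W + v).
    rewrite -(E1 _ Up); apply: kinetic_entropy_toward => // l; exact: hfeq.
  (* The weight [e / (1 + e)] balances the displacements [- v] and [e v]. *)
  have cvx : eta W <= e / (1 + e) * eta (W - v) + (1 - e / (1 + e)) * eta (W + e *: v).
    have e1N : 1 + e != 0 by rewrite gt_eqF// addr_gt0.
    have {1}-> : W = e / (1 + e) *: (W - v) + (1 - e / (1 + e)) *: (W + e *: v).
      rewrite !scalerDr scalerN scalerA addrACA -scalerDl.
      rewrite (_ : _ / _ + _ = 1) ?scale1r; last by field.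
      rewrite (_ : (1 - _) * e = e / (1 + e)); last by field.
      by rewrite addNr addr0.
    apply: strictly_convex_on_le ceta Um UWe _.
    rewrite divr_ge0 ?ler_pdivrMr/=; lra.
  have {cvx} : (1 + e) * eta W <= e * eta (W - v) + eta (W + e *: v).
    have e10 : 0 < 1 + e by rewrite addr_gt0.
    have e1N : 1 + e != 0 by rewrite gt_eqF.
    rewrite -(ler_pM2l e10) in cvx; apply: le_trans cvx _.
    rewrite le_eqVlt; apply/orP; left; apply/eqP; field.
    by [].
  lra.
rewrite -subr_le0.
set C := _ - eta W in bound.
have : e * C @[e --> 0^'+] --> (0 : R).
  rewrite -[X in _ --> X](mul0r C); apply: cvgMr_tmp.
  exact: cvg_at_right_filter.
by move=> cv; apply: ler_cvg_to (cvg_cst _) cv bound.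
Unshelve. all: by end_near.
Qed.

End Dissipation.

(** * Equilibria of the scheme *)

Lemma eq_vec3 {R : realType} (V : 'rV[R]_3) : V = vec3 (V 0 0) (V 0 1) (V 0 2).
Proof.
apply/rowP => -[[|[|[|//]]] i3]; rewrite mxE /=; congr (V 0 _); exact: val_inj.
Qed.

Lemma vec3E {R : realType} (a b c : R) :
  (vec3 a b c 0 0 = a) * (vec3 a b c 0 1 = b) * (vec3 a b c 0 2 = c).
Proof. by rewrite !mxE. Qed.

Lemma open_vec3 {R : realType} (U : set 'rV[R]_3) (W : 'rV[R]_3) :
  open U -> U W -> exists2 d, 0 < d &
    forall r m n, `|r - W 0 0| < d -> `|m - W 0 1| < d -> `|n - W 0 2| < d ->
      U (vec3 r m n).
Proof.
move=> oU UW.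
have /nbhs_ballP[d /= d0 dU] : nbhs W U by exact: open_nbhs_nbhs.
exists d => // r m n rd md nd; apply: dU; split=> // i j.
rewrite (ord1 i) {1}(eq_vec3 W).
case: j => -[|[|[|//]]] j3; rewrite !mxE /= /ball/= distrC //.
Qed.

Section Equilibria.
Context {R : realType}.
Variables dx mu arho aqx aqy gamma : R.
Hypotheses (dxN : dx != 0) (muN : mu != 0).
Local Notation feq := (equilibrium dx mu arho aqx aqy gamma).
Local Notation P := (pressure gamma).

Lemma equilibrium_consistent (W : 'rV[R]_3) :
  rho W != 0 -> macro (feq ^~ W) = W.
Proof.
rewrite /rho => rN.
rewrite /macro sum_velocity /= [RHS]eq_vec3 /eq_x /eq_y /rho /qx /qy.
by apply/rowP => -[[|[|[|//]]] i3]; rewrite !mxE /=; field; rewrite ?dxN ?muN ?rN.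
Qed.

Lemma eq_xE (s : R) (W : 'rV[R]_3) : rho W != 0 ->
  eq_x dx mu arho aqx aqy gamma s W =
  let: (a, b, c) := flux_map (s / (2 * mu)) arho aqx aqy P (W 0 0) (W 0 1) (W 0 2) in
  vec3 a b c.
Proof.
rewrite /rho => rN; rewrite /eq_x /flux_map /rho /qx /qy.
by congr vec3; field; rewrite ?dxN ?muN ?rN.
Qed.

Lemma eq_yE (s : R) (W : 'rV[R]_3) : rho W != 0 ->
  eq_y dx mu arho aqx aqy gamma s W =
  let: (a, b, c) := flux_map (s / (2 * mu)) arho aqy aqx P (W 0 0) (W 0 2) (W 0 1) in
  vec3 a c b.
Proof.
rewrite /rho => rN; rewrite /eq_y /flux_map /rho /qx /qy.
by congr vec3; field; rewrite ?dxN ?muN ?rN.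
Qed.

Lemma derivable_pressure (r : R) : 0 < r -> derivable P r 1.
Proof.
move=> r0; apply: derivable_powR.
by rewrite in_itv/= r0.
Qed.

Definition flux_regular (s ax ay r m : R) :=
  let k := s / (2 * mu) in
  k ^+ 2 * ((m / r) ^+ 2 - derive1 P r) + 2 * k * arho * (m / r) + arho * ax != 0
  /\ ay + k * (m / r) != 0.

(** The nondegeneracy conditions of [flux_map_locally_onto] for the four moving
    velocities. *)
Definition generic_state (W : 'rV[R]_3) : Prop :=
  [/\ flux_regular 1 aqx aqy (W 0 0) (W 0 1),
      flux_regular (-1) aqx aqy (W 0 0) (W 0 1),
      flux_regular 1 aqy aqx (W 0 0) (W 0 2) &
      flux_regular (-1) aqy aqx (W 0 0) (W 0 2)].

Variable U : set 'rV[R]_3.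
Hypotheses (oU : open U) (cU : convex_set U) (rho_gt0 : forall V, U V -> 0 < rho V).

Lemma cvg_coord_toward (x y : 'rV[R]_3) i :
  toward e x y 0 i @[e --> 0^'+] --> x 0 i.
Proof.
under eq_fun do rewrite !mxE.
have : (1 - e) * x 0 i + e * y 0 i @[e --> 0^'+] --> (1 - 0) * x 0 i + 0 * y 0 i.
  by apply: cvgD; apply: cvgMr_tmp; [apply: cvgB; first exact: cvg_cst|];
    exact: cvg_at_right_filter.
by rewrite subr0 mul1r mul0r addr0.
Qed.

Lemma cvg_coords_toward (x y : 'rV[R]_3) i j k :
  (toward e x y 0 i, toward e x y 0 j, toward e x y 0 k) @[e --> 0^'+] -->
  (x 0 i, x 0 j, x 0 k).
Proof.
apply: (@cvg_pair _ _ _ _ (nbhs (x 0 i, x 0 j)) (nbhs (x 0 k)));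
  last exact: cvg_coord_toward.
by apply: (@cvg_pair _ _ _ _ (nbhs (x 0 i)) (nbhs (x 0 j)));
  exact: cvg_coord_toward.
Qed.

Lemma eq_x_absorbing (s : R) (W h : 'rV[R]_3) : s != 0 -> U W ->
  flux_regular s aqx aqy (W 0 0) (W 0 1) ->
  \forall e \near 0^'+,
    (eq_x dx mu arho aqx aqy gamma s @` U)
      (toward e (eq_x dx mu arho aqx aqy gamma s W) h).
Proof.
move=> s0 UW [N0 L0]; have rW := rho_gt0 _ UW.
have [d d0 dU] := open_vec3 _ _ oU UW.
have k0 : s / (2 * mu) != 0 by rewrite mulf_neq0// invr_neq0// mulf_neq0.
have onto := flux_map_locally_onto _ _ _ _ _ _ _ (W 0 2) k0 rW
  derivable_pressure N0 L0 d d0.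
set E := eq_x _ _ _ _ _ _ _.
have EW := eq_xE s W (lt0r_neq0 rW).
have fE : flux_map (s / (2 * mu)) arho aqx aqy P (W 0 0) (W 0 1) (W 0 2) =
    (E W 0 0, E W 0 1, E W 0 2) by rewrite /E EW !vec3E.
rewrite fE in onto.
have := cvg_coords_toward _ h _ _ _ _ onto.
rewrite nbhs_simpl /=; apply: filterS => e /= [r [m [n [rd md nd te]]]].
have UV := dU _ _ _ rd md nd.
exists (vec3 r m n) => //.
have := eq_xE s (vec3 r m n) (lt0r_neq0 (rho_gt0 _ UV)).
by rewrite !vec3E -te -eq_vec3.
Qed.

Lemma eq_y_absorbing (s : R) (W h : 'rV[R]_3) : s != 0 -> U W ->
  flux_regular s aqy aqx (W 0 0) (W 0 2) ->
  \forall e \near 0^'+,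
    (eq_y dx mu arho aqx aqy gamma s @` U)
      (toward e (eq_y dx mu arho aqx aqy gamma s W) h).
Proof.
move=> s0 UW [N0 L0]; have rW := rho_gt0 _ UW.
have [d d0 dU] := open_vec3 _ _ oU UW.
have k0 : s / (2 * mu) != 0 by rewrite mulf_neq0// invr_neq0// mulf_neq0.
have onto := flux_map_locally_onto _ _ _ _ _ _ _ (W 0 1) k0 rW
  derivable_pressure N0 L0 d d0.
set E := eq_y _ _ _ _ _ _ _.
have EW := eq_yE s W (lt0r_neq0 rW).
have fE : flux_map (s / (2 * mu)) arho aqy aqx P (W 0 0) (W 0 2) (W 0 1) =
    (E W 0 0, E W 0 2, E W 0 1) by rewrite /E EW !vec3E.
rewrite fE in onto.
have := cvg_coords_toward _ h _ _ _ _ onto.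
rewrite nbhs_simpl /=; apply: filterS => e /= [r [m [n [rd md nd te]]]].
have UV := dU _ _ _ rd nd md.
exists (vec3 r n m) => //.
have := eq_yE s (vec3 r n m) (lt0r_neq0 (rho_gt0 _ UV)).
by rewrite !vec3E -te -eq_vec3.
Qed.

(** At rest the equilibrium is linear in the state, so its image is convex and
    absorbs its hull even when the map is degenerate; for the other velocities
    the image is a neighbourhood of the equilibrium of [W]. *)
Lemma equilibrium_absorbing l (W h : 'rV[R]_3) : U W -> generic_state W ->
  convex_hull (Defs.eq_set feq U l) h ->
  \forall e \near 0^'+, Defs.eq_set feq U l (toward e (feq l W) h).
Proof.
move=> UW [gxp gxm gyp gym] hh.
have N10 : -1 != 0 :> R by rewrite oppr_eq0 oner_eq0.
case: l hh => hh; [|exact: eq_x_absorbing|exact: eq_y_absorbing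
  |exact: eq_x_absorbing|exact: eq_y_absorbing].
have cD : forall x y t, 0 <= t <= 1 -> Defs.eq_set feq U v0 x ->
    Defs.eq_set feq U v0 y -> Defs.eq_set feq U v0 (t *: x + (1 - t) *: y).
  move=> _ _ t t01 [x Ux <-] [y Uy <-].
  exists (t *: x + (1 - t) *: y); first exact: (convex_setP U).1.
  apply/rowP => -[[|[|[|//]]] i3]; rewrite /= /rho /qx /qy !mxE /=; by field.
have Dh : Defs.eq_set feq U v0 h by apply: hh; split=> //; apply/convex_setP.
have DW : Defs.eq_set feq U v0 (feq v0 W) by exists W.
near=> e; rewrite /toward addrC; apply: cD => //; apply/andP; split=> //.
by near: e; exact: nbhs_right_le.
Unshelve. all: by end_near.
Qed.

Lemma near_quadratic_neq0 (a b c : R) : [|| a != 0, b != 0 | c != 0] ->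
  \forall e \near 0^'+, a + b * e + c * e ^+ 2 != 0.
Proof.
have cvge : e @[e --> 0^'+] --> (0 : R) by exact: cvg_at_right_filter.
have [->|aN _] := eqVneq a 0; last first.
  apply: (cvgr_neq0 a) => //.
  have : a + b * e + c * e ^+ 2 @[e --> 0^'+] --> a + b * 0 + c * (0 * 0).
    apply: cvgD; first by apply: cvgD; [exact: cvg_cst|exact: cvgMl_tmp].
    by apply: cvgMl_tmp; exact: cvgM.
  by rewrite !mulr0 !addr0.
have [->|bN _] := eqVneq b 0.
  rewrite /= => cN.
  by near=> e; rewrite mul0r !add0r mulf_neq0// expf_neq0// gt_eqF.
have : b + c * e @[e --> 0^'+] --> b + c * 0.
  by apply: cvgD; [exact: cvg_cst|exact: cvgMl_tmp].
rewrite mulr0 addr0 => /cvgr_neq0 /(_ bN) bce.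
near=> e; rewrite add0r expr2 mulrA -mulrDl.
by apply: mulf_neq0; [near: e|rewrite gt_eqF].
Unshelve. all: by end_near.
Qed.

(** In the normal momentum the two conditions are polynomials of degree two and
    one, whose leading coefficients do not vanish. *)
Lemma near_flux_regular (s ax ay r m d : R) : s != 0 -> 0 < r -> 0 < d ->
  \forall e \near 0^'+, flux_regular s ax ay r (m + e * d).
Proof.
move=> s0 r0 d0; set k := s / (2 * mu).
have rN : r != 0 by rewrite gt_eqF.
have k0 : k != 0 by rewrite mulf_neq0// invr_neq0// mulf_neq0.
have kd0 : k * (d / r) != 0 by rewrite mulf_neq0// mulf_neq0 ?invr_neq0// gt_eqF.
have quad := @near_quadratic_neq0
  (k ^+ 2 * ((m / r) ^+ 2 - derive1 P r) + 2 * k * arho * (m / r) + arho * ax)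
  (k ^+ 2 * (2 * (m / r) * (d / r)) + 2 * k * arho * (d / r)) ((k * (d / r)) ^+ 2).
have lin := @near_quadratic_neq0 (ay + k * (m / r)) (k * (d / r)) 0.
near=> e; split; rewrite -/k.
- have -> : k ^+ 2 * (((m + e * d) / r) ^+ 2 - derive1 P r) +
      2 * k * arho * ((m + e * d) / r) + arho * ax =
    (k ^+ 2 * ((m / r) ^+ 2 - derive1 P r) + 2 * k * arho * (m / r) + arho * ax) +
    (k ^+ 2 * (2 * (m / r) * (d / r)) + 2 * k * arho * (d / r)) * e +
    (k * (d / r)) ^+ 2 * e ^+ 2 by field.
  by near: e; apply: quad; rewrite (expf_neq0 2 kd0) !orbT.
- have -> : ay + k * ((m + e * d) / r) =
    (ay + k * (m / r)) + k * (d / r) * e + 0 * e ^+ 2 by field.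
  by near: e; apply: lin; rewrite kd0 orbT.
Unshelve. all: by end_near.
Qed.

(** Moving both momenta at once takes care of the velocities along both axes. *)
Lemma generic_ray (W : 'rV[R]_3) : U W -> exists v, [/\ U (W - v), U (W + v) &
  \forall e \near 0^'+, generic_state (W + e *: v)].
Proof.
move=> UW; have [d d0 dU] := open_vec3 _ _ oU UW.
have d2 : 0 < d / 2 by rewrite divr_gt0.
have dd : `|d / 2| < d by rewrite gtr0_norm//; lra.
exists (vec3 0 (d / 2) (d / 2)); split.
- rewrite (eq_vec3 (W - _)); apply: dU; rewrite !mxE /= addrAC subrr add0r normrN //.
  by rewrite normr0.
- rewrite (eq_vec3 (W + _)); apply: dU; rewrite !mxE /= addrAC subrr add0r //.
  by rewrite normr0.
- have r0 := rho_gt0 _ UW.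
  have N10 : -1 != 0 :> R by rewrite oppr_eq0 oner_eq0.
  near=> e; rewrite /generic_state !mxE /= mulr0 addr0; split; near: e;
    exact: near_flux_regular.
Unshelve. all: by end_near.
Qed.

End Equilibria.

(** * Sums over the lattice *)

Section LatticeSums.
Context {R : realType}.
Implicit Types (u v : site -> R) (k : R).

Lemma lattice_sum_le u v : (forall x, u x <= v x) -> (lattice_sum u <= lattice_sum v)%E.
Proof.
move=> uv; apply: leeB; apply: le_esum => x _; rewrite /= ?funeposE ?funenegE /=.
- by rewrite ge_max !le_max lee_fin uv lexx orbT.
- by rewrite ge_max !le_max lee_fin lerN2 uv lexx orbT.
Qed.

Lemma lattice_sum_fin_num u :
  summable [set: site] (EFin \o u) -> lattice_sum u \is a fin_num.
Proof.
move=> su; rewrite fin_numB; apply/andP; split.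
- have := summable_funepos su; rewrite summableE.
  by rewrite (eq_esum (fun x _ => gee0_abs (funepos_ge0 _ x))).
- have := summable_funeneg su; rewrite summableE.
  by rewrite (eq_esum (fun x _ => gee0_abs (funeneg_ge0 _ x))).
Qed.

Lemma lattice_sumD u v : summable [set: site] (EFin \o u) ->
  summable [set: site] (EFin \o v) ->
  lattice_sum (fun x => u x + v x) = (lattice_sum u + lattice_sum v)%E.
Proof.
move=> su sv.
have dif : EFin \o (fun x => u x + v x) =
    (((EFin \o u)^\+ \+ (EFin \o v)^\+) \- ((EFin \o u)^\- \+ (EFin \o v)^\-))%E.
  apply/funext => x /=; rewrite EFinD.
  rewrite !funeposE !funenegE /= -!EFin_max -!EFinD; congr EFin.
  by rewrite /Num.max; do 4!case: ifPn => ?; lra.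
rewrite /lattice_sum dif esumB; last 4 first.
- exact: summableD (summable_funepos su) (summable_funepos sv).
- exact: summableD (summable_funeneg su) (summable_funeneg sv).
- by move=> x _; rewrite adde_ge0// funepos_ge0.
- by move=> x _; rewrite adde_ge0// funeneg_ge0.
rewrite (esumD (fun x _ => funepos_ge0 _ x) (fun x _ => funepos_ge0 _ x)).
rewrite (esumD (fun x _ => funeneg_ge0 _ x) (fun x _ => funeneg_ge0 _ x)).
rewrite fin_num_oppeD; first by rewrite addeACA.
have := summable_funeneg sv; rewrite summableE.
by rewrite (eq_esum (fun x _ => gee0_abs (funeneg_ge0 _ x))).
Qed.

Lemma esum_site_gt0 k : 0 < k -> (\esum_(x in [set: site]) k%:E = +oo)%E.
Proof.
move=> k0; apply: eq_infty => r.
pose e (n : nat) : site := (n%:Z, 0).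
have inj : set_inj setT e by move=> m n _ _ [].
rewrite (esumID (range e)) => [|x _]; last by rewrite lee_fin ltW.
rewrite setTI esum_image// -nneseries_esumT => [|n]; last by rewrite lee_fin ltW.
have [n rn] : exists n : nat, r <= n%:R * k.
  exists (Num.truncn (r / k)).+1; rewrite -ler_pdivrMr//.
  by rewrite ltW// truncnS_gt.
apply: (@le_trans _ _ (n%:R * k)%:E); first by rewrite lee_fin.
apply: (@le_trans _ _ (\sum_(0 <= i < n) k%:E)%E).
  by rewrite sumEFin lee_fin big_const_nat subn0 iter_addr_0 mulr_natl.
apply: le_trans (nneseries_lim_ge _ _) _ => [i _ _|]; first by rewrite lee_fin ltW.
by rewrite leeDl// esum_ge0// => x _; rewrite lee_fin ltW.
Qed.

(** The positive part dominates [k - |v|], whose sum is infinite, and the negative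
    part is at most [|v|]. *)
Lemma esum_pos_shift v k : summable [set: site] (EFin \o v) -> 0 < k ->
  (\esum_(x in [set: site]) (EFin \o (fun x => (v x + k)%R))^\+ x = +oo /\
   \esum_(x in [set: site]) (EFin \o (fun x => (v x + k)%R))^\- x \is a fin_num)%E.
Proof.
move=> sv k0; have := sv; rewrite summableE => fv; split; last first.
  rewrite ge0_fin_numE ?esum_ge0//; apply: le_lt_trans sv.
  apply: le_esum => x _; rewrite funenegE /= ge_max !lee_fin normr_ge0 andbT.
  by rewrite opprD -normrN (le_trans _ (ler_norm _))// lerBlDr lerDl ltW.
have : (+oo <= \esum_(x in [set: site]) (EFin \o (fun x => (v x + k)%R))^\+ x +
   \esum_(x in [set: site]) `|(v x)%:E|)%E.
  rewrite -(esum_site_gt0 _ k0) -esumD//; apply: le_esum => x _.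
  rewrite funeposE /= -EFin_max -EFinD lee_fin -lerBlDr le_max; apply/orP; left.
  by rewrite addrC lerD2r lerNl -normrN ler_norm.
rewrite leye_eq => /eqP.
by case: (\esum_(x in _) _)%E fv => // r; case: esum.
Qed.

(** On an infinite lattice a nonzero constant outweighs a summable family. The
    convention [0 * +oo = 0] covers the case of a zero constant. *)
Lemma lattice_sum_addc v k : summable [set: site] (EFin \o v) ->
  lattice_sum (fun x => v x + k) = (lattice_sum v + k%:E * +oo)%E.
Proof.
move=> sv; have fv := lattice_sum_fin_num _ sv.
have [k0|k0|->] := ltgtP k 0; last first.
- by rewrite mul0e adde0; congr lattice_sum; apply/funext => x; rewrite addr0.
- have [pos neg] := esum_pos_shift _ _ sv k0.
  rewrite /lattice_sum pos -/(lattice_sum v) gt0_muley ?lte_fin//.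
  by move: neg fv; case: esum => // r _; case: lattice_sum.
- have sNv : summable [set: site] (EFin \o (fun x => - v x)).
    by move: sv; rewrite summableN.
  have Nk0 : 0 < - k by rewrite oppr_gt0.
  have [pos neg] := esum_pos_shift _ _ sNv Nk0.
  have opp x : v x + k = - (- v x + - k) by rewrite opprD !opprK.
  have posE : (EFin \o (fun x => (v x + k)%R))^\+%E =
      (EFin \o (fun x => (- v x - k)%R))^\-%E.
    by apply/funext => x; rewrite funeposE funenegE /= opp.
  have negE : (EFin \o (fun x => (v x + k)%R))^\-%E =
      (EFin \o (fun x => (- v x - k)%R))^\+%E.
    by apply/funext => x; rewrite funeposE funenegE /= opp opprK.
  rewrite [LHS]/lattice_sum posE negE pos lt0_muley ?lte_fin//.
  by move: neg fv; case: esum => // r _; case: lattice_sum.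
Qed.

Lemma bij_site_shift (c : site) : set_bij [set: site] [set: site] (fun x => x - c).
Proof.
by rewrite setTT_bijective; exists (fun x => x + c) => x; rewrite ?subrK ?addrK.
Qed.

Lemma summable_shift (c : site) v :
  summable [set: site] (EFin \o v) ->
  summable [set: site] (EFin \o (fun x => v (x - c))).
Proof. by rewrite /summable (reindex_esum _ _ _ _ (bij_site_shift c)). Qed.

Lemma lattice_sum_shift (c : site) v : lattice_sum (fun x => v (x - c)) = lattice_sum v.
Proof.
rewrite /lattice_sum; congr (_ - _)%E.
- rewrite [RHS](reindex_esum _ _ _ _ (bij_site_shift c)).
  by apply: eq_esum => x _; rewrite !funeposE.
- rewrite [RHS](reindex_esum _ _ _ _ (bij_site_shift c)).
  by apply: eq_esum => x _; rewrite !funenegE.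
Qed.

Lemma lattice_sum_sum (I : Type) (r : seq I) (v : I -> site -> R) :
  (forall i, summable [set: site] (EFin \o v i)) ->
  summable [set: site] (EFin \o (fun x => \sum_(i <- r) v i x)) /\
  lattice_sum (fun x => \sum_(i <- r) v i x) = (\sum_(i <- r) lattice_sum (v i))%E.
Proof.
move=> sv; elim: r => [|i r [ihs ihl]].
  have -> : (fun x => \sum_(i <- [::]) v i x) = (fun=> 0 : R).
    by apply/funext => x; rewrite big_nil.
  split; first by rewrite /summable esum1// => x _; rewrite /= normr0.
  rewrite big_nil /lattice_sum !esum1 ?sube0// => x _;
    by rewrite ?funeposE ?funenegE /= ?oppr0 maxxx.
have -> : (fun x => \sum_(j <- i :: r) v j x) = (fun x => v i x + \sum_(j <- r) v j x).
  by apply/funext => x; rewrite big_cons.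
split; last by rewrite big_cons -ihl lattice_sumD.
exact: summableD (sv i) ihs.
Qed.

(** Both sides are the sum of the [lattice_sum (u l - k l)], plus an infinite
    term with the sign of the sum of the [k l]. *)
Lemma lattice_sum_transport (u : velocity -> site -> R) (k : velocity -> R)
    (c : velocity -> site) :
  (forall l, summable [set: site] (EFin \o (fun x => u l x - k l))) ->
  lattice_sum (fun x => \sum_l u l (x - c l)) = lattice_sum (fun x => \sum_l u l x).
Proof.
move=> su.
have su' l := summable_shift (c l) _ (su l).
have split (w : velocity -> site -> R) :
    (fun x => \sum_l w l x) = (fun x => \sum_l (w l x - k l) + \sum_l k l).
  by apply/funext => x; rewrite -big_split; apply: eq_bigr => l _; rewrite /= subrK.
have [s1 e1] := lattice_sum_sum _ (index_enum velocity) _ su.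
have [s2 e2] := lattice_sum_sum _ (index_enum velocity) _ su'.
rewrite (split u) (split (fun l x => u l (x - c l))) !lattice_sum_addc// e1 e2.
by congr (_ + _)%E; apply: eq_bigr => l _;
  exact: (lattice_sum_shift (c l) (fun x => u l x - k l)).
Qed.

End LatticeSums.

(** * The scheme *)

Section Relaxation.
Context {R : realType}.
Variables (feq : velocity -> 'rV[R]_3 -> 'rV[R]_3) (U : set 'rV[R]_3).
Variables (H : velocity -> 'rV[R]_3 -> R) (omega : R).
Variable f : nat -> site -> velocity -> 'rV[R]_3.
Hypotheses (omega01 : 0 <= omega <= 1).
Hypotheses (sol : scheme_solution feq omega f) (start : equilibrium_start feq f).
Hypothesis UW : forall n x, U (macro (f n x)).

Lemma relax_in_hull (g : velocity -> 'rV[R]_3) l : U (macro g) ->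
  convex_hull (Defs.eq_set feq U l) (g l) ->
  convex_hull (Defs.eq_set feq U l) (relax feq omega g l).
Proof.
move=> Ug hg; rewrite /relax addrC; apply: convex_hull_conv => //.
by apply: sub_convex_hull; exists (macro g).
Qed.

(** [H_l] is evaluated on the solution only within the hull of [D_l], where it is
    convex: relaxation with [omega] in [[0, 1]] is a convex combination with a
    point of [D_l]. *)
Lemma solution_in_hull n x l : convex_hull (Defs.eq_set feq U l) (f n x l).
Proof.
elim: n x => [|n IHn] x; last by rewrite sol; exact: relax_in_hull.
by rewrite start; apply: sub_convex_hull; exists (macro (f 0 x)).
Qed.

Lemma relax_entropy_le n x : kinetic_convex H feq U ->
  kinetic_entropy H (feq ^~ (macro (f n x))) <= kinetic_entropy H (f n x) ->
  kinetic_entropy H (relax feq omega (f n x)) <= kinetic_entropy H (f n x).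
Proof.
move=> cH gibbs.
have hfeq l : convex_hull (Defs.eq_set feq U l) (feq l (macro (f n x))).
  by apply: sub_convex_hull; exists (macro (f n x)).
have /andP[w0 _] := omega01.
have := kinetic_entropy_toward _ _ _ cH _ _ _ omega01 (solution_in_hull n x) hfeq.
move=> /le_trans; apply.
have := ler_wpM2l w0 gibbs; lra.
Qed.

End Relaxation.

Theorem proposition2 (R : realType) (dt dx mu arho aqx aqy gamma omega : R)
    (U : set 'rV[R]_3) (eta : 'rV[R]_3 -> R)
    (H : velocity -> 'rV[R]_3 -> R)
    (f : nat -> site -> velocity -> 'rV[R]_3)
    (feq := equilibrium dx mu arho aqx aqy gamma)
    (W := fun (n : nat) (x : site) => macro (f n x))
    (fs := fun (n : nat) (x : site) => relax feq omega (f n x)) :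
  0 < dt -> 0 < dx -> dx ^+ 2 / dt = mu -> 1 <= gamma ->
  open U -> convex_set U -> (forall V, U V -> 0 < rho V) ->
  strictly_convex_on U eta ->
  kinetic_convex H feq U -> cond_E1 H feq U eta -> cond_E2 H feq U ->
  scheme_solution feq omega f -> equilibrium_start feq f ->
  (forall n x, U (W n x)) ->
  0 < omega <= 1 ->
  (forall (n : nat) (x : site),
     kinetic_entropy H (f n.+1 x) <=
     kinetic_entropy H (f n x)
     - dt / dx * (flux_east H mu dx (fs n) x - flux_west H mu dx (fs n) x)
     - dt / dx * (flux_north H mu dx (fs n) x - flux_south H mu dx (fs n) x))
  /\
  (kinetic_summable H f ->
   forall n : nat,
     (lattice_sum (fun x => eta (W n x)) <=
      lattice_sum (fun x => eta (W 0%N x)))%E).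
Proof.
move=> dt0 dx0 muE _ oU cU rho_gt0 ceta cH E1 E2 sol start UW /andP[w0 w1].
have dtN : dt != 0 by rewrite gt_eqF.
have dxN : dx != 0 by rewrite gt_eqF.
have muN : mu != 0 by rewrite -muE mulf_neq0 ?invr_neq0// expf_neq0.
have w01 : 0 <= omega <= 1 by rewrite ltW.
have consistent V : U V -> macro (feq ^~ V) = V.
  by move=> UV; apply: equilibrium_consistent => //; rewrite gt_eqF// rho_gt0.
have hull n x l : convex_hull (Defs.eq_set feq U l) (f n x l).
  exact: (solution_in_hull feq U omega f w01 sol start UW).
have gibbs n x : eta (W n x) <= kinetic_entropy H (f n x).
  apply: (entropy_min_on_convex_hull feq U H eta cH E2 consistent
    (generic_state mu arho aqx aqy gamma)) => //.
  - by move=> V UV; exact: generic_ray.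
  - by move=> l V h UV gV; exact: equilibrium_absorbing.
  - exact: UW.
have relaxed n x : kinetic_entropy H (fs n x) <= kinetic_entropy H (f n x).
  apply: (relax_entropy_le feq U H omega f w01 sol start UW _ _ cH).
  rewrite {1}/kinetic_entropy E1; [exact: gibbs|exact: UW].
have transport n x : kinetic_entropy H (f n.+1 x) =
    \sum_l H l (fs n (x - direction l) l).
  by rewrite /kinetic_entropy; apply: eq_bigr => l _; rewrite sol.
split=> [n x|smbl n].
  have fluxE (a b : R) : dt / dx * (mu * (a / dx) - mu * (b / dx)) = a - b.
    by rewrite -muE; field; rewrite dtN dxN.
  rewrite /flux_east /flux_west /flux_north /flux_south !fluxE.
  have := relaxed n x; rewrite transport.
  rewrite [in X in X <= _ -> _]/kinetic_entropy !sum_velocity /= subr0 !opprK.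
  lra.
have decay m : (lattice_sum (fun x => kinetic_entropy H (f m x)) <=
    lattice_sum (fun x => kinetic_entropy H (f 0%N x)))%E.
  elim: m => [//|m IHm]; apply: le_trans IHm.
  (* The constants at infinity of the relaxed distributions are those of the next
     time, as transport is a shift. *)
  have [k sk] : exists k : velocity -> R, forall l,
      summable [set: site] (EFin \o (fun x => H l (fs m x l) - k l)).
    have /= /choice [k sk] := smbl m.+1.
    exists k => l; have := summable_shift (- direction l) _ (sk l).
    rewrite /summable; congr (_ < _)%E; apply: eq_esum => x _ /=.
    by rewrite sol opprK addrK.
  have tr : (fun x => kinetic_entropy H (f m.+1 x)) =
      (fun x => \sum_l (fun l x => H l (fs m x l)) l (x - direction l)).
    by apply/funext => x; exact: transport.
  rewrite tr (lattice_sum_transport _ _ _ sk).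
  by apply: lattice_sum_le => x; exact: relaxed.
apply: (@le_trans _ _ (lattice_sum (fun x => kinetic_entropy H (f n x)))).
  by apply: lattice_sum_le => x; exact: gibbs.
apply: le_trans (decay n) _; apply: lattice_sum_le => x.
rewrite -E1; last exact: UW.
by rewrite le_eqVlt; apply/orP; left; apply/eqP; apply: eq_bigr => l _; rewrite start.
Qed.
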